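(* For any $r\in(0,1)$ there is a sequence $\{v_m\}$ such that the rates $r_m$ of the extended BCH codes $\mathrm{eBCH}(v_m,m)$ satisfy $r_m\to r$ and the sequence $\{\mathrm{eBCH}(v_m,m)\}_m$ is capacity achieving on the BEC under bit-MAP decoding.
   Context: Let $\alpha$ be a primitive element of $\mathbb{F}_{2^m}$. For $1\le v\le 2^m-1$, let $f(m,v)$ be the lowest-degree polynomial over $\mathbb{F}_2$ having $\alpha,\alpha^2,\dots,\alpha^v$ as roots; $\mathrm{BCH}(v,m)$ is the binary cyclic code of length $2^m-1$ with generator polynomial $f(m,v)$ (primitive narrow-sense BCH code with designed distance $v+1$). $\mathrm{eBCH}(v,m)$ is the length-$2^m$ code obtained by appending to each codeword of $\mathrm{BCH}(v,m)$ an overall parity bit making the total weight even. A uniform codeword $\underline{X}$ is sent over $\mathrm{BEC}(p)$ (each bit independently erased with probability $p$) giving $\underline{Y}$; $P_b(p)=\frac1N\sum_i\Pr(X_i\text{ not uniquely determined by }\underline{Y})$. A sequence with rates $r_n\to r\in(0,1)$ is capacity achieving under bit-MAP decoding if $P_b^{(n)}(p)\to0$ for all $p\in[0,1-r)$. *)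

(* Defs.v *)
From HB Require Import structures.
From Stdlib Require Import Reals ClassicalEpsilon.
From mathcomp Require Import all_boot all_order all_algebra all_field.
Set Implicit Arguments. Unset Strict Implicit. Unset Printing Implicit Defensive.
Import GRing.Theory.

Section BCH.
Variable F : finFieldType.
Local Open Scope ring_scope.

(* the (unique) embedding of F_2 into F (a ring morphism when char F = 2) *)
Definition emb2 (b : 'F_2) : F := (val b)%:R.

Definition has_BCH_roots (alpha : F) (v : nat) (g : {poly 'F_2}) : Prop :=
  forall j : nat, (1 <= j <= v)%N -> root (map_poly emb2 g) (alpha ^+ j).

(* g is a lowest-degree (nonzero) polynomial over F_2 with these roots;
   over F_2 a nonzero polynomial is monic, so such g is unique *)
Definition is_BCH_gen (alpha : F) (v : nat) (g : {poly 'F_2}) : Prop :=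
  [/\ g != 0, has_BCH_roots alpha v g &
      forall h : {poly 'F_2}, h != 0 -> has_BCH_roots alpha v h -> (size g <= size h)%N].

(* f(m,v) : the generator polynomial (chosen by Hilbert's epsilon; the
   defining property pins it down uniquely) *)
Definition BCH_gen (alpha : F) (v : nat) : {poly 'F_2} :=
  epsilon (inhabits 0) (is_BCH_gen alpha v).

Definition word_poly (m : nat) (x : {ffun 'I_(2 ^ m) -> 'F_2}) : {poly 'F_2} :=
  \sum_(i < 2 ^ m | (i < 2 ^ m - 1)%N) (x i)%:P * 'X^i.

(* eBCH(v,m): the first 2^m - 1 coordinates form a codeword of BCH(v,m)
   (a multiple of f(m,v)), and the last coordinate is the overall parity bit
   (total sum is 0). *)
Definition eBCH (m v : nat) (alpha : F) : {set {ffun 'I_(2 ^ m) -> 'F_2}} :=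
  [set x | (BCH_gen alpha v %| word_poly x) && (\sum_(i < 2 ^ m) x i == 0)].
End BCH.

Section Erasure.
Local Open Scope R_scope.
Variable N : nat.
Variable C : {set {ffun 'I_N -> 'F_2}}.

Definition code_rate : R := ln (INR #|C|) / (ln 2 * INR N).

(* given transmitted codeword x and erased set E, bit i is not uniquely
   determined by Y iff some codeword agrees with x off E but differs at i *)
Definition bit_undetermined (E : {set 'I_N}) (i : 'I_N) (x : {ffun 'I_N -> 'F_2}) : bool :=
  [exists c in C, [forall j, (j \notin E) ==> (c j == x j)] && (c i != x i)].

(* Pr(X_i not uniquely determined by Y), X uniform on C, erasures iid(p) *)
Definition prob_undetermined (p : R) (i : 'I_N) : R :=
  \big[Rplus/0]_(E : {set 'I_N})
     (p ^ #|E| * (1 - p) ^ (N - #|E|) *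
      (INR #|[set x in C | bit_undetermined E i x]| / INR #|C|)).

Definition P_b (p : R) : R :=
  / INR N * \big[Rplus/0]_(i : 'I_N) prob_undetermined p i.
End Erasure.

(* Main.v *)
Require Import Defs.
From Stdlib Require Import Reals ClassicalEpsilon.
From HB Require Import structures.
From mathcomp Require Import all_boot all_order all_algebra all_fingroup all_field.
From mathcomp Require Import polyrcf Rstruct zify ring lra.
Set Implicit Arguments. Unset Strict Implicit. Unset Printing Implicit Defensive.
Import Order.TTheory GRing.Theory Num.Theory.
Local Open Scope ring_scope.
Bind Scope ring_scope with R.
#[local] Arguments ln x%_ring_scope.

(** For a linear code with a doubly transitive automorphism group, the event
    "bit [i] cannot be recovered from the other, unerased, bits" is monotone in the
    erasure pattern, its probability [h p] (the EXIT function) does not depend on [i],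
    and all coordinates other than [i] have the same influence on it.  A log-Sobolev
    argument (Falik-Samorodnitsky) gives [4 I >= Var * ln (1 / theta)], where [I] is
    the total influence and [theta] bounds each single influence.  As equal influences
    are at most [I / (N - 1)], [h] has a sharp threshold: [I = h'] by Margulis-Russo.
    The threshold is located by the area theorem: [N h] is the derivative of the
    expected dimension of the subcode supported on the erased set, whence
    [h p * (1 - p) <= rate], so [h] stays away from [1] below [1 - rate] and must
    therefore be small there.

    A word of eBCH(v, m), with coordinates indexed by the field, is one whose power
    sums of exponents [0, ..., v] vanish; this is invariant under affine maps, which
    act doubly transitively.  Passing from [v] to [v + 1] adds one equation with values
    in a field of size [2 ^ m], so the rates move in steps of at most [m / 2 ^ m]. *)

(** * Averaging and difference operators for the product Bernoulli measure on subsets *)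

Section Averaging.
Variables (T : finType) (A : comNzRingType) (w : A).
Implicit Types (f g : {set T} -> A) (S : {set T}) (i j : T) (s : seq T).

(** The bias [w] lies in an arbitrary commutative ring: a real [w] gives expectations, and [w = 'X]
    gives them as polynomials in the bias, which can be differentiated. *)
Definition avg i f : {set T} -> A :=
  fun S => w * f (i |: S) + (1 - w) * f (S :\ i).

Definition dif i f : {set T} -> A := fun S => f (i |: S) - f (S :\ i).

Definition avgs s f : {set T} -> A := foldr avg f s.

Definition weight S : A := \prod_(i : T) (if i \in S then w else 1 - w).

Definition expect f : A := \sum_(S : {set T}) weight S * f S.

Lemma eq_expect f g : f =1 g -> expect f = expect g.
Proof. by move=> fg; apply: eq_bigr => S _; rewrite fg. Qed.

Lemma expectD f g : expect (fun S => f S + g S) = expect f + expect g.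
Proof. by rewrite -big_split; apply: eq_bigr => S _; rewrite mulrDr. Qed.

Lemma expectB f g : expect (fun S => f S - g S) = expect f - expect g.
Proof. by rewrite -sumrB; apply: eq_bigr => S _; rewrite mulrBr. Qed.

Lemma expectZ a f : expect (fun S => a * f S) = a * expect f.
Proof. by rewrite mulr_sumr; apply: eq_bigr => S _; rewrite mulrCA. Qed.

Lemma weight_card S : weight S = w ^+ #|S| * (1 - w) ^+ (#|T| - #|S|).
Proof.
rewrite /weight (bigID (fun i => i \in S)) /=; congr (_ * _).
  rewrite (eq_bigr (fun=> w)) => [|i ->] //.
  by rewrite prodr_const.
rewrite (eq_bigr (fun=> 1 - w)) => [|i /negbTE ->] //.
by rewrite prodr_const -(cardC (mem S)) addKn.
Qed.

Lemma weight_setU1 i S : i \notin S -> weight (i |: S) =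
  w * \prod_(j | j != i) (if j \in S then w else 1 - w).
Proof.
move=> iS; rewrite /weight (bigD1 i) //= setU11; congr (_ * _).
by apply: eq_bigr => j /negbTE ji; rewrite !inE ji.
Qed.

Lemma weight_setD1 i S : i \notin S -> weight S =
  (1 - w) * \prod_(j | j != i) (if j \in S then w else 1 - w).
Proof. by move=> iS; rewrite /weight (bigD1 i) //= (negbTE iS). Qed.

Lemma sum_set_split i f :
  \sum_(S : {set T}) f S = \sum_(S : {set T} | i \notin S) (f (i |: S) + f S).
Proof.
rewrite (bigID (fun S => i \notin S)) /= big_split /= addrC; congr (_ + _).
rewrite (reindex_onto (fun S => i |: S) (fun S => S :\ i)) /=.
  apply: eq_bigl => S; rewrite setU11 /=.
  case: (boolP (i \in S)) => iS; last by rewrite setU1K ?eqxx.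
  by apply/eqP => /setP /(_ i); rewrite !inE eqxx iS.
by move=> S; rewrite negbK => iS; rewrite setD1K.
Qed.

Lemma expect_avg i f : expect (avg i f) = expect f.
Proof.
rewrite /expect !(sum_set_split i); apply: eq_bigr => S iS.
rewrite weight_setU1 // (weight_setD1 iS) /avg !setUA setUid setU1K //.
rewrite (_ : S :\ i = S); first by ring.
by apply/setDidPl; rewrite disjoint_sym disjoints1.
Qed.

Lemma expect_avgs s f : expect (avgs s f) = expect f.
Proof. by elim: s => //= i s IH; rewrite expect_avg. Qed.

Lemma sum_weight : \sum_(S : {set T}) weight S = 1.
Proof.
pose F (i : T) (b : bool) := if b then w else 1 - w.
have := bigA_distr_bigA (one := 1) (plus := +%R) (times := *%R) F.
rewrite big1 => [->|i _]; last by rewrite big_bool /=; ring.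
rewrite (reindex (fun S : {set T} => [ffun i => i \in S])) /=.
  by apply: eq_bigr => S _; apply: eq_bigr => i _; rewrite ffunE.
exists (fun h : {ffun T -> bool} => [set i | h i]) => [S _|h _].
  by apply/setP => i; rewrite inE ffunE.
by apply/ffunP => i; rewrite ffunE inE.
Qed.

Lemma expect_const a : expect (fun=> a) = a.
Proof. by rewrite /expect -mulr_suml sum_weight mul1r. Qed.

Lemma avg_setU1 i f S : avg i f (i |: S) = avg i f S.
Proof.
by rewrite /avg setUA setUid; congr (_ + _ * f _); apply/setP => j; rewrite !inE;
  case: eqP.
Qed.

Lemma avg_setD1 i f S : avg i f (S :\ i) = avg i f S.
Proof.
by rewrite /avg; congr (_ * f _ + _ * f _); apply/setP => j; rewrite !inE; case: eqP.
Qed.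

Lemma dif_setU1 i f S : dif i f (i |: S) = dif i f S.
Proof.
by rewrite /dif setUA setUid; congr (_ - f _); apply/setP => j; rewrite !inE;
  case: eqP.
Qed.

Lemma dif_setD1 i f S : dif i f (S :\ i) = dif i f S.
Proof.
by rewrite /dif; congr (f _ - f _); apply/setP => j; rewrite !inE; case: eqP.
Qed.

Lemma eq_avg i f g : f =1 g -> avg i f =1 avg i g.
Proof. by move=> fg S; rewrite /avg !fg. Qed.

Lemma dif_avg i f S : dif i (avg i f) S = 0.
Proof. by rewrite {1}/dif avg_setU1 avg_setD1 subrr. Qed.

Lemma avg_dif i f S : avg i (dif i f) S = dif i f S.
Proof. by rewrite {1}/avg dif_setU1 dif_setD1; ring. Qed.

Lemma setU1_D1 i j S : i != j -> (i |: S) :\ j = i |: (S :\ j).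
Proof.
move=> ij; apply/setP => k; rewrite !inE; case: (eqVneq k i) => [->|] //=.
by rewrite ij.
Qed.

Lemma setD1C i j S : S :\ i :\ j = S :\ j :\ i.
Proof. by rewrite !setDDl setUC. Qed.

Lemma dif_avgC i j f S : i != j -> dif i (avg j f) S = avg j (dif i f) S.
Proof.
move=> ij; have ji : j != i by rewrite eq_sym.
rewrite /avg /dif (setU1_D1 S ij) (setU1_D1 S ji) (setUCA [set j] [set i] S).
by rewrite (setD1C i j); ring.
Qed.

Lemma avgs_indep i s f S : i \in s -> avgs s f (i |: S) = avgs s f S /\
  avgs s f (S :\ i) = avgs s f S.
Proof.
elim: s S => //= j s IH S; rewrite inE.
case: (eqVneq i j) => [<- _|ij /= si]; first by rewrite avg_setU1 avg_setD1.
have ji : j != i by rewrite eq_sym.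
rewrite /avg (setU1_D1 S ij) (setUCA [set j] [set i] S) (setD1C i j).
rewrite -(setU1_D1 S ji).
by rewrite !(IH _ si).1 !(IH _ si).2.
Qed.

Lemma avgs_const f S S' : avgs (enum T) f S = avgs (enum T) f S'.
Proof.
suff H S0 : avgs (enum T) f S0 = avgs (enum T) f set0 by rewrite !H.
elim: {S0}#|_| {-2}S0 (erefl #|S0|) => [|n IH] S0 /eqP.
  by rewrite cards_eq0 => /eqP ->.
move=> /eqP c; have [i iS] : exists i, i \in S0 by apply/card_gt0P; rewrite c.
rewrite -(avgs_indep f S0 (mem_enum T i)).2; apply: IH.
by move: c; rewrite (cardsD1 i) iS => -[].
Qed.

Lemma avgs_expect f S : avgs (enum T) f S = expect f.
Proof.
by rewrite -(expect_avgs (enum T)) (eq_expect (fun S' => avgs_const f S' S)) expect_const.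
Qed.

Lemma avg_mull i f g S :
  avg i (fun S' => avg i f S' * g S') S = avg i f S * avg i g S.
Proof. by rewrite {1 4}/avg avg_setU1 avg_setD1; ring. Qed.

(** [avg i] is an orthogonal projection for the form [expect (f * g)], so this is Pythagoras. *)
Lemma expect_avg_var i f :
  expect (fun S => (f S - avg i f S) ^+ 2) =
  expect (fun S => f S ^+ 2) - expect (fun S => avg i f S ^+ 2).
Proof.
have e : expect (fun S => avg i f S * f S) = expect (fun S => avg i f S ^+ 2).
  by rewrite -(expect_avg i); apply: eq_expect => S; rewrite avg_mull expr2.
rewrite (_ : expect _ = expect (fun S => f S ^+ 2) + expect (fun S => avg i f S ^+ 2)
   - 2 * expect (fun S => avg i f S * f S)); first by rewrite e; ring.
rewrite -expectZ -expectD -expectB; apply: eq_expect => S; ring.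
Qed.

(** Pythagoras telescopes along the chain of averages, where [drop k s] averages one coordinate more
    than [drop k.+1 s]: [dif i] commutes with averaging over [j != i] and vanishes after averaging
    over [i]. *)
Lemma avgs_dif_sqr i f s :
  \sum_(k < size s) expect (fun S => (dif i (avgs (drop k.+1 s) f) S
     - dif i (avgs (drop k s) f) S) ^+ 2) =
  expect (fun S => dif i f S ^+ 2) - expect (fun S => dif i (avgs s f) S ^+ 2).
Proof.
elim: s => [|j s IH]; first by rewrite big_ord0 subrr.
rewrite big_ord_recl /= drop0 IH.
suff -> : expect (fun S => (dif i (avgs s f) S - dif i (avg j (avgs s f)) S) ^+ 2) =
  expect (fun S => dif i (avgs s f) S ^+ 2)
     - expect (fun S => dif i (avg j (avgs s f)) S ^+ 2) by ring.
case: (eqVneq i j) => [<-|ij].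
  rewrite -expectB; apply: eq_expect => S; rewrite dif_avg; ring.
transitivity (expect (fun S => (dif i (avgs s f) S - avg j (dif i (avgs s f)) S) ^+ 2)).
  by apply: eq_expect => S; rewrite dif_avgC.
rewrite expect_avg_var; congr (_ - _).
by apply: eq_expect => S; rewrite dif_avgC.
Qed.

Lemma avgs_sqr f s :
  \sum_(k < size s) expect (fun S => (avgs (drop k.+1 s) f S
     - avgs (drop k s) f S) ^+ 2) =
  expect (fun S => f S ^+ 2) - expect (fun S => avgs s f S ^+ 2).
Proof.
elim: s => [|j s IH]; first by rewrite big_ord0 subrr.
rewrite big_ord_recl /= drop0 IH expect_avg_var; ring.
Qed.

End Averaging.

(** * Logarithm estimates and the two-point log-Sobolev inequality *)

Lemma ln_le_sub1 (x : R) : 0 < x -> ln x <= x - 1.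
Proof.
move=> /RltP x0; have /RleP := exp_ineq1_le (ln x).
by rewrite exp_ln //; rewrite -[Rplus _ _]/(1 + ln x) => ?; lra.
Qed.

Lemma lnM (x y : R) : 0 < x -> 0 < y -> ln (x * y) = ln x + ln y.
Proof. by move=> /RltP x0 /RltP y0; apply: ln_mult. Qed.

Lemma ln1 : ln 1 = 0 :> R.
Proof. exact: ln_1. Qed.

Lemma lnB (x y : R) : 0 < x -> 0 < y -> ln (x / y) = ln x - ln y.
Proof.
move=> x0 y0; have := @lnM (x / y) y (divr_gt0 x0 y0) y0.
by rewrite divfK ?gt_eqF // => ->; rewrite addrK.
Qed.

Lemma ln_mono_le (x y : R) : 0 < x -> x <= y -> ln x <= ln y.
Proof.
move=> x0 xy; have y0 := lt_le_trans x0 xy.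
have := ln_le_sub1 (divr_gt0 x0 y0); rewrite lnB // => h.
suff : x / y <= 1 by lra.
by rewrite ler_pdivrMr ?mul1r.
Qed.

(** For [y != 0], write [z / zb] as [(y / yb) * (z * yb / (zb * y))] and apply [ln t <= t - 1] to
    each factor. *)
Lemma mul_ln_ratio_le (y yb z zb : R) : 0 <= y -> 0 < yb -> 0 <= z -> 0 < zb ->
  (y != 0 -> 0 < z) ->
  y * (ln z - ln zb) <= y ^+ 2 / yb + z * yb / zb - 2 * y.
Proof.
move=> y0 yb0 z0 zb0; case: (eqVneq y 0) => [-> _|yN0 /(_ isT) zp].
  by rewrite mul0r expr0n /= mul0r mulr0 subr0 add0r divr_ge0 ?mulr_ge0 // ltW.
have yp : 0 < y by rewrite lt_def yN0.
have h1 := ln_le_sub1 (divr_gt0 yp yb0).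
have h2 := ln_le_sub1 (divr_gt0 (mulr_gt0 zp yb0) (mulr_gt0 zb0 yp)).
move: h1 h2; rewrite !lnB ?lnM ?mulr_gt0 // => h1 h2.
have h : ln z - ln zb <= y / yb - 1 + (z * yb / (zb * y) - 1) by lra.
apply: le_trans (ler_wpM2l y0 h) _.
rewrite le_eqVlt; apply/orP; left; apply/eqP; field.
by rewrite yN0 !gt_eqF.
Qed.

(** The weights [z1], [z0] are not tied to the squares of [a], [b], because the chain of averages
    takes the logarithm of a function already averaged over other coordinates. *)
Lemma two_point_log_sobolev (p a b z1 z0 : R) (zb := p * z1 + (1 - p) * z0) :
  0 < p < 1 ->
  0 <= z1 -> 0 <= z0 -> (a != 0 -> 0 < z1) -> (b != 0 -> 0 < z0) ->
  p * (a ^+ 2 * (ln z1 - ln zb)) + (1 - p) * (b ^+ 2 * (ln z0 - ln zb))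
    <= 2 * (a - b) ^+ 2.
Proof.
move=> /andP[p0 p1] z10 z00 az bz; have q0 : 0 < 1 - p by lra.
case: (boolP ((a == 0) && (b == 0))) => [/andP[/eqP -> /eqP ->]|ab].
  by rewrite expr0n /= !mul0r !mulr0 addr0 subr0 expr0n mulr0.
have zb0 : 0 < zb.
  move: ab; rewrite negb_and => /orP[/az|/bz] zp.
    by rewrite ltr_pwDl ?mulr_gt0 ?mulr_ge0 // ltW.
  by rewrite ltr_wpDl ?mulr_gt0 ?mulr_ge0 // ltW.
set yb := p * a ^+ 2 + (1 - p) * b ^+ 2.
have yb0 : 0 < yb.
  have := sqr_ge0 a; have := sqr_ge0 b.
  move: ab; rewrite negb_and -(sqrf_eq0 a) -(sqrf_eq0 b) => /orP[] zp b0 a0.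
    apply: ltr_pwDl; first by apply: mulr_gt0; rewrite // lt_def zp.
    by apply: mulr_ge0; rewrite // ltW.
  apply: ltr_wpDl; first by apply: mulr_ge0; rewrite // ltW.
  by apply: mulr_gt0; rewrite // lt_def zp.
have h1 : a ^+ 2 * (ln z1 - ln zb) <= _ :=
  mul_ln_ratio_le (sqr_ge0 a) yb0 z10 zb0 ltac:(by rewrite sqrf_eq0).
have h0 : b ^+ 2 * (ln z0 - ln zb) <= _ :=
  mul_ln_ratio_le (sqr_ge0 b) yb0 z00 zb0 ltac:(by rewrite sqrf_eq0).
apply: le_trans (lerD (ler_wpM2l (ltW p0) h1) (ler_wpM2l (ltW q0) h0)) _.
(* The [z] terms add up to [yb], as [zb] is the mean of [z1] and [z0]; what remains is the variance
   of the squares divided by [yb]. *)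
have -> : p * ((a ^+ 2) ^+ 2 / yb + z1 * yb / zb - 2 * a ^+ 2) +
  (1 - p) * ((b ^+ 2) ^+ 2 / yb + z0 * yb / zb - 2 * b ^+ 2) =
  (p * (1 - p) * (a + b) ^+ 2 / yb) * (a - b) ^+ 2.
  have e : p * z1 / zb + (1 - p) * z0 / zb = 1 by rewrite -mulrDl divff ?gt_eqF.
  transitivity ((p * (a ^+ 2) ^+ 2 + (1 - p) * (b ^+ 2) ^+ 2) / yb +
     yb * (p * z1 / zb + (1 - p) * z0 / zb) - 2 * yb).
    by rewrite /yb; field; rewrite !gt_eqF.
  by rewrite e /yb; field; rewrite gt_eqF.
apply: ler_wpM2r; rewrite ?sqr_ge0 // ler_pdivrMr // /yb.
rewrite -subr_ge0 (_ : _ - _ =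
  p * (1 - p) * (a - b) ^+ 2 + 2 * (p * a) ^+ 2 + 2 * ((1 - p) * b) ^+ 2).
  have := sqr_ge0 (p * a); have := sqr_ge0 ((1 - p) * b).
  by have := mulr_ge0 (ltW (mulr_gt0 p0 q0)) (sqr_ge0 (a - b)); lra.
by ring.
Qed.

(** * Log-Sobolev inequality on the cube and the variance-influence bound *)

Section RealExpectation.
Variables (T : finType) (p : R).
Hypothesis p01 : 0 < p < 1.
Implicit Types (f g d : {set T} -> R) (S : {set T}) (i j : T) (s : seq T).
Local Notation avgp := (avg p).
Local Notation avgsp := (avgs p).
Local Notation expectp := (expect p).

Let p0 : 0 < p. Proof. by case/andP: p01. Qed.
Let q0 : 0 < 1 - p. Proof. by rewrite subr_gt0; case/andP: p01. Qed.

Lemma weight_gt0 S : 0 < weight p S.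
Proof. by apply: prodr_gt0 => i _; case: ifP. Qed.

Lemma expect_le f g : (forall S, f S <= g S) -> expectp f <= expectp g.
Proof. by move=> fg; apply: ler_sum => S _; rewrite ler_wpM2l // ltW ?weight_gt0. Qed.

Lemma expect_ge0 f : (forall S, 0 <= f S) -> 0 <= expectp f.
Proof. by move=> f0; apply: sumr_ge0 => S _; rewrite mulr_ge0 // ltW ?weight_gt0. Qed.

Lemma avg_ge0 i f : (forall S, 0 <= f S) -> forall S, 0 <= avgp i f S.
Proof. by move=> f0 S; rewrite addr_ge0 // mulr_ge0 // ltW. Qed.

Lemma avgs_ge0 s f : (forall S, 0 <= f S) -> forall S, 0 <= avgsp s f S.
Proof. by move=> f0; elim: s => //= i s IH; apply: avg_ge0. Qed.

Lemma mem_setU1_id i S : i \in S -> i |: S = S.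
Proof. by move=> iS; apply/setUidPr; rewrite sub1set. Qed.

Lemma notin_setD1_id i S : i \notin S -> S :\ i = S.
Proof. by move=> iS; apply/setDidPl; rewrite disjoint_sym disjoints1. Qed.

Lemma avgs_gt0 s f S : (forall S, 0 <= f S) -> 0 < f S -> 0 < avgsp s f S.
Proof.
move=> f0 fS; elim: s => //= i s IH; rewrite /avg.
case: (boolP (i \in S)) => iS.
  by rewrite mem_setU1_id // ltr_pwDl ?mulr_gt0 ?mulr_ge0 ?avgs_ge0 // ltW.
by rewrite notin_setD1_id // ltr_wpDl ?mulr_gt0 ?mulr_ge0 ?avgs_ge0 // ltW.
Qed.

(** The entropy telescopes over [s]; each increment, with the other coordinates fixed, is an
    instance of the two-point inequality. *)
Lemma log_sobolev_seq d s (Y := fun S => d S ^+ 2) :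
  expectp (fun S => Y S * ln (Y S)) - expectp (fun S => Y S * ln (avgsp s Y S))
    <= 2 * \sum_(i <- s) expectp (fun S => dif i d S ^+ 2).
Proof.
have Y0 S : 0 <= Y S by apply: sqr_ge0.
elim: s => [|i s IH]; first by rewrite subrr big_nil mulr0.
rewrite big_cons mulrDr /=; set Z := avgsp s Y in IH *.
suff : expectp (fun S => Y S * ln (Z S)) - expectp (fun S => Y S * ln (avgp i Z S))
   <= 2 * expectp (fun S => dif i d S ^+ 2) by lra.
rewrite -expectB -(expect_avg _ i) -expectZ; apply: expect_le => S.
have h : (fun S => Y S * ln (Z S) - Y S * ln (avgp i Z S)) =1
  (fun S => Y S * (ln (Z S) - ln (avgp i Z S))) by move=> ?; rewrite mulrBr.
rewrite (eq_avg _ _ h) {1}/avg avg_setU1 avg_setD1.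
have Zp S' : d S' != 0 -> 0 < Z S'.
  by move=> dS; apply: avgs_gt0 => //; rewrite exprn_even_gt0.
by apply: two_point_log_sobolev => //; try apply: avgs_ge0; try apply: Zp.
Qed.

Lemma log_sobolev d :
  expectp (fun S => d S ^+ 2 * ln (d S ^+ 2))
    - expectp (fun S => d S ^+ 2) * ln (expectp (fun S => d S ^+ 2))
    <= 2 * \sum_i expectp (fun S => dif i d S ^+ 2).
Proof.
have := log_sobolev_seq d (enum T); rewrite big_enum /=.
apply: le_trans; rewrite lerD2l lerN2.
rewrite (eq_expect _ (g := fun S => ln (expectp (fun S => d S ^+ 2)) * d S ^+ 2)).
  by rewrite expectZ mulrC.
by move=> S; rewrite avgs_expect mulrC.
Qed.

Lemma sub_avg_abs i f S : `|f S - avgp i f S| <= `|dif i f S|.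
Proof.
rewrite /avg /dif; case: (boolP (i \in S)) => iS.
  rewrite mem_setU1_id // (_ : _ - _ = (1 - p) * (f S - f (S :\ i))); last by ring.
  by rewrite normrM ler_piMl // gtr0_norm // lerBlDr lerDl ltW.
rewrite notin_setD1_id // (_ : _ - _ = - p * (f (i |: S) - f S)); last by ring.
by rewrite normrM ler_piMl // normrN gtr0_norm // -subr_ge0 ltW.
Qed.

Lemma avg_abs i f S : `|avgp i f S| <= avgp i (fun S => `|f S|) S.
Proof.
apply: le_trans (ler_normD _ _) _.
by rewrite !normrM (gtr0_norm p0) (gtr0_norm q0).
Qed.

Lemma expect_dif_avgs_abs i s f :
  expectp (fun S => `|dif i (avgsp s f) S|) <= expectp (fun S => `|dif i f S|).
Proof.
elim: s => //= j s; apply: le_trans.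
case: (eqVneq i j) => [<-|ij].
  by apply: expect_le => S; rewrite dif_avg normr0.
rewrite -[X in _ <= X](expect_avg _ j); apply: expect_le => S.
by rewrite dif_avgC // avg_abs.
Qed.

Lemma expect_dif_avgs_sqr i s f :
  expectp (fun S => dif i (avgsp s f) S ^+ 2) <= expectp (fun S => dif i f S ^+ 2).
Proof.
rewrite -subr_ge0 -avgs_dif_sqr; apply: sumr_ge0 => k _.
by apply: expect_ge0 => S; apply: sqr_ge0.
Qed.

(* Falik-Samorodnitsky: the log-Sobolev inequality is applied to each martingale
   difference of [f], and the Dirichlet forms of these differences add up to at
   most the Dirichlet form of [f]. *)
Lemma variance_log_influence f (theta : R) : 0 < theta ->
  (forall i, expectp (fun S => dif i f S ^+ 2) <= theta) ->
  (expectp (fun S => f S ^+ 2) - expectp f ^+ 2) * (- ln theta)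
    <= 2 * \sum_i (expectp (fun S => dif i f S ^+ 2) + expectp (fun S => `|dif i f S|)).
Proof.
move=> th0 hth; pose s := enum T.
pose d (k : nat) S := avgsp (drop k.+1 s) f S - avgsp (drop k s) f S.
pose m k := expectp (fun S => d k S ^+ 2).
have step (k : 'I_(size s)) : m k * (- ln theta)
  <= 2 * \sum_j expectp (fun S => dif j (d k) S ^+ 2)
   + 2 * expectp (fun S => `|dif (tnth (in_tuple s) k) f S|).
  set i := tnth _ k.
  have dk S : `|d k S| <= `|dif i (avgsp (drop k.+1 s) f) S|.
    have ik : nth i s k = i by rewrite [RHS](tnth_nth i).
    by rewrite /d (drop_nth i (ltn_ord k)) /= ik; apply: sub_avg_abs.
  have a_le : expectp (fun S => `|d k S|) <= expectp (fun S => `|dif i f S|).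
    by apply: le_trans (expect_le dk) _; apply: expect_dif_avgs_abs.
  have m_le : m k <= theta.
    apply: le_trans (hth i); apply: le_trans (expect_dif_avgs_sqr _ (drop k.+1 s) _).
    apply: expect_le => S; rewrite -[X in X <= _]real_normK ?num_real //.
    by rewrite -[X in _ <= X]real_normK ?num_real // lerXn2r ?nnegrE.
  have m0 : 0 <= m k by apply: expect_ge0 => S; apply: sqr_ge0.
  have mln : m k * ln (m k) <= m k * ln theta.
    case: (eqVneq (m k) 0) => [->|mN0]; first by rewrite !mul0r.
    by apply: ler_wpM2l => //; apply: ln_mono_le => //; rewrite lt_def mN0.
  (* With [u] the absolute value of [d k S], [ln (1 / u) <= 1 / u - 1] gives [u ^+ 2 * ln (u ^+ 2)
     >= 2 * u ^+ 2 - 2 * u]. *)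
  have low : 2 * m k - 2 * expectp (fun S => `|d k S|)
     <= expectp (fun S => d k S ^+ 2 * ln (d k S ^+ 2)).
    rewrite -!expectZ -expectB; apply: expect_le => S.
    case: (eqVneq (d k S) 0) => [->|dN0].
      by rewrite normr0 expr0n /= mul0r !mulr0 subr0.
    have np : 0 < `|d k S| by rewrite normr_gt0.
    rewrite -[d k S ^+ 2]real_normK ?num_real //; move: `|_| np => u u0.
    have := ln_le_sub1 (divr_gt0 (@ltr01 R) u0).
    rewrite lnB // ln1.
    rewrite expr2 (lnM u0 u0) => /(ler_wpM2l (ltW (mulr_gt0 u0 u0))).
    have -> : u * u * (1 / u - 1) = u - u * u by field; rewrite gt_eqF.
    by lra.
  have := log_sobolev (d k); rewrite -/(m k); nra.
have var : \sum_(k < size s) m k = expectp (fun S => f S ^+ 2) - expectp f ^+ 2.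
  rewrite avgs_sqr; congr (_ - _).
  by under eq_expect do rewrite avgs_expect; rewrite expect_const.
rewrite -var mulr_suml big_split mulrDr /=.
apply: le_trans (ler_sum _ (fun k _ => step k)) _; rewrite big_split /= -!mulr_sumr.
apply: lerD; rewrite ler_wpM2l //; last first.
  rewrite -(big_tuple _ _ (in_tuple s) predT
    (fun i => expectp (fun S => `|dif i f S|))) /=.
  by rewrite big_enum.
(* After the exchange, linearity of [dif j] turns the sum over [k] into the telescoping sum of
   [avgs_dif_sqr]. *)
rewrite exchange_big; apply: ler_sum => j _ /=.
have := avgs_dif_sqr p j f s.
set X := \sum_(k < _) _; set Y := \sum_(k < _) _ => e.
have -> : Y = X.
  apply: eq_bigr => k _; apply: eq_expect => S; congr (_ ^+ 2).
  by rewrite /dif /d; ring.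
rewrite e lerBlDr lerDl; apply: expect_ge0 => S; apply: sqr_ge0.
Qed.

End RealExpectation.

(** * Margulis-Russo formula, through polynomials in the bias *)

Section Russo.
Variable T : finType.
Implicit Types (f : {set T} -> R) (S : {set T}) (i j : T) (s : seq T) (p : R).

Definition expect_poly f : {poly R} := expect 'X (fun S => (f S)%:P).

Lemma horner_expect_poly f p : (expect_poly f).[p] = expect p f.
Proof.
rewrite horner_sum; apply: eq_bigr => S _; rewrite hornerM hornerC; congr (_ * _).
rewrite /weight horner_prod; apply: eq_bigr => i _.
by case: ifP; rewrite !hornerE.
Qed.

Lemma deriv_avg i (F : {set T} -> {poly R}) S :
  (avg 'X i F S)^`() = dif i F S + avg 'X i (fun S => (F S)^`()) S.
Proof. by rewrite /avg /dif derivD !derivM derivB derivX derivC; ring. Qed.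

(** Product rule, one coordinate at a time; [uniq s] lets the [dif i] produced at [i] move through
    the averages over the rest of [s]. *)
Lemma deriv_avgs s f S : uniq s -> (avgs 'X s (fun S => (f S)%:P) S)^`() =
  \sum_(i <- s) avgs 'X s (dif i (fun S => (f S)%:P)) S.
Proof.
elim: s S => [|i s IH] S /=; first by rewrite big_nil derivC.
case/andP=> is_ us; rewrite big_cons deriv_avg; congr (_ + _).
  have c t S' : i \notin t -> dif i (avgs 'X t (fun S => (f S)%:P)) S' =
      avgs 'X t (dif i (fun S => (f S)%:P)) S'.
    elim: t S' => //= j t IHt S'; rewrite inE negb_or => /andP[ij it].
    by rewrite dif_avgC //; apply: eq_avg => S''; apply: IHt.
  rewrite -[LHS](avg_dif 'X); apply: eq_avg => S'; exact: c.
rewrite (eq_avg _ _ (IH^~ us)) /avg !mulr_sumr -big_split.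
by apply: eq_bigr.
Qed.

(* Margulis-Russo formula *)
Lemma deriv_expect_poly f : (expect_poly f)^`() = \sum_i expect_poly (dif i f).
Proof.
rewrite /expect_poly -(avgs_expect _ _ set0) deriv_avgs ?enum_uniq // big_enum /=.
apply: eq_bigr => i _; rewrite avgs_expect; apply: eq_expect => S.
by rewrite /dif polyCB.
Qed.

(** Expectations are polynomials in the bias, so the mean value theorem for polynomials applies; it
    takes the place of integrating the derivative. *)
Lemma expect_mvt f (a b : R) : a < b -> exists2 c, a < c < b &
  expect b f - expect a f = (\sum_i expect c (dif i f)) * (b - a).
Proof.
move=> ab; have [c] := poly_mvt (expect_poly f) ab.
rewrite in_itv /= !horner_expect_poly deriv_expect_poly horner_sum => cab ->.
by exists c => //; congr (_ * _); apply: eq_bigr => i _; rewrite horner_expect_poly.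
Qed.

End Russo.

(** * Endpoint values and permutation invariance of expectations *)

Section ExpectationIdentities.
Variables (T : finType) (A : comNzRingType).
Implicit Types (f : {set T} -> A).

Lemma expect0 f : expect 0 f = f set0.
Proof.
rewrite /expect (bigD1 set0) //= big1 => [|S SN0].
  by rewrite weight_card cards0 expr0 subr0 expr1n !mul1r addr0.
rewrite weight_card expr0n cards_eq0 (negbTE SN0) /=; ring.
Qed.

Lemma expect1 f : expect 1 f = f setT.
Proof.
rewrite /expect (bigD1 setT) //= big1 => [|S SNT].
  by rewrite weight_card cardsT subnn expr0 expr1n !mul1r addr0.
have c : (#|T| - #|S| == 0)%N = false.
  apply/negbTE; rewrite subn_eq0 -ltnNge -cardsT proper_card //.
  by rewrite properEneq SNT subsetT.
rewrite weight_card subrr expr0n c /=; ring.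
Qed.

Lemma expect_perm (w : A) f (s : {perm T}) :
  expect w (fun E => f (s @^-1: E)) = expect w f.
Proof.
rewrite [RHS](reindex_inj (h := fun E : {set T} => s @^-1: E)) /=.
  apply: eq_bigr => E _; congr (_ * _); rewrite !weight_card.
  rewrite card_preimset //; exact: perm_inj.
move=> E1 E2 e; apply/setP => i; have /setP/(_ (s^-1%g i)) := e.
by rewrite !inE permKV.
Qed.

End ExpectationIdentities.

(** * Recoverability of a coordinate of a linear code, and its EXIT function *)

Section Code.
Variables (T : finType) (C : {set {ffun T -> 'F_2}}).
Implicit Types (c x : {ffun T -> 'F_2}) (E : {set T}) (i j : T) (s : {perm T}).

Definition linear_code := 0 \in C /\ {in C &, forall c x, c + x \in C}.

Definition code_aut s := forall c, ([ffun t => c (s t)] \in C) = (c \in C).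

Definition doubly_transitive := forall i j i' j', i != j -> i' != j' ->
  exists2 s, code_aut s & s i = i' /\ s j = j'.

Definition subcode E := [set c in C | [forall j, (j \notin E) ==> (c j == 0)]].

(* The value at [i] cannot be recovered when the coordinates in [i |: E] are erased. *)
Definition extr_undet i E := [exists c in subcode (i |: E), c i != 0].

Lemma subcodeP c E :
  reflect (c \in C /\ forall j, j \notin E -> c j = 0) (c \in subcode E).
Proof.
rewrite inE; apply: (iffP andP) => -[cC h]; split=> //.
  by move=> j jE; apply/eqP; move/forallP/(_ j): h; rewrite jE.
by apply/forallP => j; apply/implyP => /h ->.
Qed.

Lemma extr_undetP i E :
  reflect (exists c, [/\ c \in C, forall j, j \notin i |: E -> c j = 0 & c i != 0])
    (extr_undet i E).
Proof.
apply: (iffP existsP) => [[c /andP[/subcodeP[cC h] ci]]|[c [cC h ci]]].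
  by exists c.
by exists c; rewrite ci andbT; apply/subcodeP.
Qed.

Lemma extr_undet_sub i E E' : E \subset E' -> extr_undet i E -> extr_undet i E'.
Proof.
move=> /subsetP sE /extr_undetP[c [cC h ci]]; apply/extr_undetP; exists c; split=> //.
move=> j; rewrite !inE negb_or => /andP[ji jE]; apply: h.
by rewrite !inE negb_or ji; apply: contra jE => /sE.
Qed.

Lemma extr_undet_self i E : extr_undet i (i |: E) = extr_undet i (E :\ i).
Proof.
rewrite /extr_undet (_ : i |: (i |: E) = i |: E :\ i) //.
by apply/setP => j; rewrite !inE; case: eqP.
Qed.

Lemma F2_neq0 (a : 'F_2) : (a != 0) = (a == 1).
Proof. by case: a => -[|[|[]]]. Qed.

Lemma F2_addxx (a : 'F_2) : a + a = 0.
Proof. by case: a => -[|[|[]]] // H; apply/val_inj. Qed.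

Hypothesis C_lin : linear_code.

(** The words of [subcode (i |: E)] vanishing at [i] form [subcode (E :\ i)]. If some word is
    nonzero at [i], translation by it matches them with the others and the size doubles; otherwise
    the two subcodes coincide. *)
Lemma card_subcode_setU1 i E :
  #|subcode (i |: E)| = ((extr_undet i E).+1 * #|subcode (E :\ i)|)%N.
Proof.
have [C0 CD] := C_lin.
have e : subcode (E :\ i) = subcode (i |: E) :&: [set c : {ffun T -> 'F_2} | c i == 0].
  apply/setP => c; apply/subcodeP/setIP => [[cC h]|[/subcodeP[cC h] ci]].
    split; last by rewrite inE (h i) ?setD11.
    apply/subcodeP; split=> // j.
    by rewrite !inE negb_or => /andP[ji jE]; apply: h; rewrite !inE ji.
  split=> // j; case: (eqVneq j i) => [->|ji] jE; first by move: ci; rewrite inE => /eqP.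
  by apply: h; move: jE; rewrite !inE (negbTE ji).
case: (boolP (extr_undet i E)) => [/extr_undetP[c0 [c0C h0 ci0]]|/extr_undetP hN].
  rewrite mul2n -addnn -(cardsID [set c : {ffun T -> 'F_2} | c i == 0] (subcode _)) -e.
  congr (_ + _)%N.
  rewrite e -[RHS](card_imset _ (addrI c0)); apply: eq_card => c.
  apply/setDP/imsetP => [[/subcodeP[cC h]]|[c1 /setIP[/subcodeP[cC h] ci] ->]].
    rewrite inE F2_neq0 => /eqP ci1; exists (c0 + c); last first.
      by rewrite addrA (_ : c0 + c0 = 0) ?add0r //; apply/ffunP => t; rewrite !ffunE F2_addxx.
    rewrite inE; apply/andP; split; last first.
      by move: ci0; rewrite inE ffunE F2_neq0 ci1 => /eqP ->.
    by apply/subcodeP; split; [apply: CD|move=> j jE; rewrite ffunE h0 // h // addr0].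
  split; last by move: ci; rewrite !inE ffunE => /eqP ->; rewrite addr0.
  by apply/subcodeP; split; [apply: CD|move=> j jE; rewrite ffunE h0 // h // addr0].
suff <- : subcode (i |: E) = subcode (E :\ i) by rewrite mul1n.
rewrite e; apply/esym/setIidPl/subsetP => c /subcodeP[cC h]; rewrite inE.
by apply/negPn/negP => ci; apply: hN; exists c.
Qed.

Lemma card_subcode_gt0 E : (0 < #|subcode E|)%N.
Proof.
apply/card_gt0P; exists 0; apply/subcodeP; split; first exact: C_lin.1.
by move=> j _; rewrite ffunE.
Qed.

(** For a linear code this is the dimension of the subcode. *)
Definition log_subcode E : R := ln (#|subcode E|%:R) / ln 2.

Lemma ln2_gt0 : 0 < ln 2 :> R.
Proof.
have := ln_le_sub1 (divr_gt0 (@ltr01 R) (@ltr0Sn R 1)).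
rewrite lnB ?ltr01 ?ltr0Sn // ln1.
lra.
Qed.

Lemma dif_log_subcode i E : dif i log_subcode E = (extr_undet i E)%:R.
Proof.
have l0 := ln2_gt0.
rewrite /dif /log_subcode -mulrBl card_subcode_setU1 natrM.
have c0 : 0 < #|subcode (E :\ i)|%:R :> R by rewrite ltr0n card_subcode_gt0.
case: extr_undet; rewrite lnM ?ltr0Sn // addrK.
  by rewrite divff ?gt_eqF.
by rewrite ln1 mul0r.
Qed.

Definition exit_fun i (p : R) : R := expect p (fun E => (extr_undet i E)%:R).

Definition exit_inf i j (p : R) : R :=
  expect p (dif j (fun E => (extr_undet i E)%:R)).

(** This comes from monotonicity in [E]. Hence the mean, mean square and mean absolute value of the
    difference all equal the influence [exit_inf]. *)
Lemma dif_extr_undet_bool i j E : exists b : bool,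
  dif j (fun E => (extr_undet i E)%:R : R) E = b%:R.
Proof.
rewrite /dif; have := @extr_undet_sub i (E :\ j) (j |: E).
case: (extr_undet _ (E :\ j)) => [->//|_].
- by exists false; rewrite subrr.
- apply/subsetP => k; rewrite !inE => /andP[_ ->]; exact: orbT.
by exists (extr_undet i (j |: E)); rewrite subr0.
Qed.

Lemma dif_extr_undet_self i E : dif i (fun E => (extr_undet i E)%:R : R) E = 0.
Proof. by rewrite /dif extr_undet_self subrr. Qed.

Lemma exit_inf_self i p : exit_inf i i p = 0.
Proof.
by rewrite /exit_inf (eq_expect _ (dif_extr_undet_self i)) expect_const.
Qed.

Lemma exit_inf_ge0 i j (p : R) : 0 < p < 1 -> 0 <= exit_inf i j p.
Proof.
move=> p01; apply: expect_ge0 => // E; have [b ->] := dif_extr_undet_bool i j E.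
exact: ler0n.
Qed.

Lemma exit_inf_sqr i j p :
  expect p (fun E => dif j (fun E => (extr_undet i E)%:R) E ^+ 2) = exit_inf i j p.
Proof.
apply: eq_expect => E; have [b ->] := dif_extr_undet_bool i j E.
by case: b; rewrite ?expr1n ?expr0n.
Qed.

Lemma exit_inf_abs i j p :
  expect p (fun E => `|dif j (fun E => (extr_undet i E)%:R) E|) = exit_inf i j p.
Proof.
by apply: eq_expect => E; have [b ->] := dif_extr_undet_bool i j E; rewrite normr_nat.
Qed.

Lemma exit_fun_itv i (p : R) : 0 < p < 1 -> 0 <= exit_fun i p <= 1.
Proof.
move=> p01; apply/andP; split; first by apply: expect_ge0 => // E; apply: ler0n.
rewrite -[X in _ <= X](expect_const T p); apply: expect_le => // E.
by rewrite -[1]/(1%:R) ler_nat leq_b1.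
Qed.

Lemma exit_fun_mono i (a b : R) : 0 < a -> a <= b -> b < 1 ->
  exit_fun i a <= exit_fun i b.
Proof.
move=> a0; rewrite le_eqVlt => /orP[/eqP -> //|ab] b1.
have [c /andP[ac cb] e] := expect_mvt (fun E => (extr_undet i E)%:R) ab.
rewrite -subr_ge0 /exit_fun e mulr_ge0 ?subr_ge0 ?(ltW ab) //.
apply: sumr_ge0 => j _; apply: exit_inf_ge0.
by rewrite (lt_trans a0 ac) (lt_trans cb b1).
Qed.

Lemma extr_undet_aut s i E : code_aut s ->
  extr_undet (s i) E = extr_undet i (s @^-1: E).
Proof.
move=> sC; apply/extr_undetP/extr_undetP => -[c [cC h ci]].
  exists [ffun t => c (s t)]; rewrite sC ffunE; split=> // j.
  rewrite !inE negb_or => /andP[ji jE]; rewrite ffunE h // !inE negb_or jE andbT.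
  by rewrite (inj_eq perm_inj).
exists [ffun t => c (s^-1%g t)]; split.
- by rewrite -sC (_ : [ffun t => _] = c) //; apply/ffunP => t; rewrite !ffunE permK.
- move=> j; rewrite !inE negb_or => /andP[ji jE]; rewrite ffunE h //.
  rewrite !inE permKV negb_or jE andbT; apply: contra ji => /eqP <-.
  by rewrite permKV.
by rewrite ffunE permK.
Qed.

Lemma exit_fun_aut s i p : code_aut s -> exit_fun (s i) p = exit_fun i p.
Proof.
move=> sC; rewrite /exit_fun -[RHS](expect_perm _ _ s); apply: eq_expect => E.
by rewrite extr_undet_aut.
Qed.

Lemma exit_inf_aut s i j p : code_aut s ->
  exit_inf (s i) (s j) p = exit_inf i j p.
Proof.
move=> sC; rewrite /exit_inf -[RHS](expect_perm _ _ s); apply: eq_expect => E.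
rewrite /dif !extr_undet_aut //; congr (_%:R - _%:R); congr (nat_of_bool (extr_undet i _)).
  by apply/setP => k; rewrite !inE (inj_eq perm_inj).
by apply/setP => k; rewrite !inE (inj_eq perm_inj).
Qed.

(** * Area theorem and sharp threshold under double transitivity *)

Hypothesis C_dt : doubly_transitive.

Lemma exit_inf_const i j i' j' p : i != j -> i' != j' ->
  exit_inf i j p = exit_inf i' j' p.
Proof.
move=> ij ij'; have [s sC [<- <-]] := C_dt ij ij'.
by rewrite exit_inf_aut.
Qed.

Hypothesis T_gt1 : (1 < #|T|)%N.

Lemma exists_neq i : exists j : T, i != j.
Proof.
have := T_gt1; rewrite -cardsT (cardsD1 i) inE ltnS => /card_gt0P[j].
by rewrite !inE andbT eq_sym => ?; exists j.
Qed.

Lemma exit_fun_const i i' p : exit_fun i p = exit_fun i' p.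
Proof.
have [[j ij] [j' ij']] := (exists_neq i, exists_neq i').
have [s sC [<- _]] := C_dt ij ij'.
by rewrite exit_fun_aut.
Qed.

(* The derivative of the expected log-size of the erased subcode is the sum of the
   EXIT functions; integrating from [p] to [1] is the area theorem. *)
Lemma exit_fun_rate i (p : R) : 0 < p < 1 ->
  exit_fun i p * (1 - p) <= ln (#|C|%:R) / (ln 2 * #|T|%:R).
Proof.
move=> p01; have /andP[p0 p1] := p01.
(* The mean value theorem stands in for the integral; monotonicity of [exit_fun] then passes from
   [c] to [p]. *)
have [c /andP[pc c1]] := expect_mvt log_subcode p1.
rewrite expect1 (eq_bigr (fun=> exit_fun i c)); last first.
  move=> j _; rewrite (exit_fun_const i j); apply: eq_expect => E.
  exact: dif_log_subcode.
rewrite sumr_const => e.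
have l0 := ln2_gt0.
have n0 : 0 < #|T|%:R :> R by rewrite ltr0n (ltn_trans _ T_gt1).
have eT : log_subcode setT = ln #|C|%:R / ln 2.
  congr (ln (_%:R) / _); apply: eq_card => x; apply/subcodeP/idP => [[]//|xC].
  by split=> // j; rewrite inE.
have rho0 : 0 <= expect p log_subcode.
  apply: expect_ge0 => // E; apply: divr_ge0; last exact: ltW.
  by rewrite -ln1; apply: ln_mono_le; rewrite // ler1n card_subcode_gt0.
have h : exit_fun i p <= exit_fun i c by apply: exit_fun_mono => //; apply: ltW.
rewrite invfM mulrA -eT ler_pdivlMr //.
have q0 : 0 <= 1 - p by rewrite subr_ge0 ltW.
have := ler_wpM2r (ltW n0) (ler_wpM2r q0 h).
have : log_subcode setT >= exit_fun i c * #|T|%:R * (1 - p) by rewrite mulr_natr -e; lra.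
by move: (exit_fun i c) => u; nra.
Qed.

(** At a mean value point [c] the total influence is at most [1 / (b - a)], while [exit_fun] lies
    between [e] and [1 - e'], so the indicator has variance at least [e * e']. The factor [#|T|.-1]
    appears because [i] has no influence on itself. *)
Lemma exit_fun_threshold i (a b e e' : R) :
  0 < a -> a < b -> b < 1 -> 0 <= e -> 0 <= e' ->
  e <= exit_fun i a -> exit_fun i b <= 1 - e' ->
  e * e' * ln ((#|T|.-1)%:R * (b - a)) * (b - a) <= 4.
Proof.
move=> a0 ab b1 e0 e'0 ha hb.
have [c /andP[ac cb] h] := expect_mvt (fun E => (extr_undet i E)%:R) ab.
have c01 : 0 < c < 1 by rewrite (lt_trans a0 ac) (lt_trans cb b1).
have n0 : 0 < (#|T|.-1)%:R :> R by rewrite ltr0n -ltnS prednK // (ltn_trans _ T_gt1).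
have ba0 : 0 < b - a by rewrite subr_gt0.
set I := \sum_i0 _ in h.
have [j ij] := exists_neq i.
have eI : I = (#|T|.-1)%:R * exit_inf i j c.
  rewrite /I (bigD1 i) //= -/(exit_inf i i c) exit_inf_self add0r.
  rewrite (eq_bigr (fun=> exit_inf i j c)).
    by rewrite sumr_const -(cardC1 i) mulr_natl.
  by move=> k ki; rewrite -/(exit_inf i k c); apply: exit_inf_const; rewrite // eq_sym.
have I1 : I * (b - a) <= 1.
  rewrite -h; have := @exit_fun_itv i a; have := @exit_fun_itv i b.
  rewrite a0 b1 (lt_trans a0 ab) (lt_trans ab b1) => /(_ isT)/andP[_ +] /(_ isT)/andP[+ _].
  by rewrite /exit_fun; lra.
have hc1 : exit_fun i a <= exit_fun i c.
  by apply: exit_fun_mono; rewrite ?(ltW ac) //; case/andP: c01.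
have hc2 : exit_fun i c <= exit_fun i b.
  by apply: exit_fun_mono; rewrite ?(ltW cb) //; case/andP: c01.
(* This [theta] bounds each influence, since [#|T|.-1] equal influences add up to
   [I <= 1 / (b - a)]. *)
have th0 : 0 < ((#|T|.-1)%:R * (b - a))^-1 by rewrite invr_gt0 mulr_gt0.
have := @variance_log_influence T c c01 (fun E => (extr_undet i E)%:R) _ th0.
rewrite -/(exit_fun i c).
have -> : expect c (fun E => (extr_undet i E)%:R ^+ 2) = exit_fun i c.
  by apply: eq_expect => E; case: extr_undet; rewrite ?expr1n ?expr0n.
under eq_bigr do rewrite exit_inf_sqr exit_inf_abs.
have -> : - ln ((#|T|.-1)%:R * (b - a))^-1 = ln ((#|T|.-1)%:R * (b - a)).
  by rewrite -[_^-1]mul1r lnB ?mulr_gt0 // ln1 sub0r opprK.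
move=> H.
have {H} : (exit_fun i c - exit_fun i c ^+ 2) * ln ((#|T|.-1)%:R * (b - a)) <= 4 * I.
  apply: le_trans (H _) _.
    move=> k; rewrite exit_inf_sqr; case: (eqVneq i k) => [<-|ik].
      by rewrite exit_inf_self ltW.
    rewrite (exit_inf_const c ik ij) invfM ler_pdivlMl // -eI.
    by rewrite -[_^-1]mul1r ler_pdivlMr.
  rewrite big_split /= -/(exit_inf i) (_ : \sum_k exit_inf i k c = I) //; lra.
move: (ln _) => L H.
have v : e * e' <= exit_fun i c - exit_fun i c ^+ 2.
  rewrite (_ : _ - _ = exit_fun i c * (1 - exit_fun i c)); last by ring.
  by apply: ler_pM => //; lra.
have [L0|L0] := lerP 0 L.
  have := ler_wpM2r (ltW ba0) (le_trans (ler_wpM2r L0 v) H).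
  by move/le_trans; apply; lra.
(* A negative logarithm makes the left-hand side nonpositive. *)
have : e * e' * L * (b - a) <= 0.
  by rewrite mulr_le0_ge0 ?(ltW ba0) // mulr_ge0_le0 ?mulr_ge0 // ltW.
lra.
Qed.

End Code.

(** * Bit erasure probability bounded by the EXIT function *)

Section ErasureBound.
Variables (N : nat) (C : {set {ffun 'I_N -> 'F_2}}).
Hypothesis C_lin : linear_code C.

Definition undet_frac (i : 'I_N) (E : {set 'I_N}) : R :=
  #|[set x in C | bit_undetermined C E i x]|%:R / #|C|%:R.

Lemma prob_undeterminedE (p : R) i :
  prob_undetermined C p i = expect p (undet_frac i).
Proof.
apply: eq_bigr => E _; rewrite weight_card card_ord /undet_frac.
by rewrite -!RpowE -!INRE.
Qed.

Lemma undet_frac_ge0 i E : 0 <= undet_frac i E.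
Proof. by rewrite divr_ge0. Qed.

(** Two codewords that agree off [E] and differ at [i] add up to a codeword supported on [E] and
    nonzero at [i]. Equality can fail because [extr_undet] also erases [i]. *)
Lemma undet_frac_le i E : undet_frac i E <= (extr_undet C i E)%:R.
Proof.
rewrite /undet_frac; case: (boolP (extr_undet C i E)) => [_|/extr_undetP hN].
  have c0 : 0 < #|C|%:R :> R by rewrite ltr0n; apply/card_gt0P; exists 0; apply: C_lin.1.
  rewrite ler_pdivrMr // mul1r ler_nat; apply: subset_leq_card.
  by apply/subsetP => x; rewrite inE => /andP[].
rewrite (_ : [set x in C | _] = set0) ?cards0 ?mul0r //.
apply/setP => x; rewrite !inE; apply/negP => /andP[xC].
case/existsP=> c /andP[cC /andP[/forallP h ci]]; apply: hN.
exists (c + x); split; first exact: C_lin.2.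
  move=> j; rewrite !inE negb_or => /andP[_ jE]; move: (h j); rewrite jE ffunE => /eqP ->.
  exact: F2_addxx.
rewrite ffunE; apply: contra ci => /eqP e.
by rewrite -[c i]addr0 -(F2_addxx (x i)) addrA e add0r.
Qed.

Lemma undet_frac0 i : undet_frac i set0 = 0.
Proof.
rewrite /undet_frac (_ : [set x in C | _] = set0) ?cards0 ?mul0r //.
apply/setP => x; rewrite !inE; apply/negP => /andP[xC].
case/existsP=> c /andP[cC /andP[/forallP h ci]]; move: (h i); rewrite inE /=.
by move=> e; rewrite e in ci.
Qed.

Lemma P_bE (p : R) : P_b C p = N%:R^-1 * \sum_i expect p (undet_frac i).
Proof.
rewrite /P_b INRE; congr (_ * _); apply: eq_bigr => i _.
exact: prob_undeterminedE.
Qed.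

Lemma code_rateE : code_rate C = ln (#|C|%:R) / (ln 2 * N%:R).
Proof. by rewrite /code_rate !INRE. Qed.

(** The threshold argument works for [0 < p < 1]; this settles the endpoint. *)
Lemma P_b0 : P_b C 0 = 0.
Proof.
by rewrite P_bE big1 ?mulr0 // => i _; rewrite expect0 undet_frac0.
Qed.

Lemma P_b_ge0 (p : R) : 0 < p < 1 -> 0 <= P_b C p.
Proof.
move=> p01; rewrite P_bE mulr_ge0 ?invr_ge0 //; apply: sumr_ge0 => i _.
by apply: expect_ge0 => // E; apply: undet_frac_ge0.
Qed.

Hypothesis C_dt : doubly_transitive C.
Hypothesis N_gt1 : (1 < N)%N.

Lemma P_b_le_exit i (p : R) : 0 < p < 1 -> P_b C p <= exit_fun C i p.
Proof.
move=> p01; have n0 : 0 < N%:R :> R by rewrite ltr0n (ltn_trans _ N_gt1).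
rewrite P_bE ler_pdivrMl //.
apply: le_trans (_ : \sum_(j < N) exit_fun C i p <= _); last first.
  by rewrite sumr_const card_ord mulr_natl.
apply: ler_sum => j _; rewrite (exit_fun_const C_dt _ i j) ?card_ord //.
by apply: expect_le => // E; apply: undet_frac_le.
Qed.

(** At the auxiliary point [b] the area theorem gives [exit_fun C i b <= r / (1 - b) < 1], which
    provides the gap [e' = 1 - r / (1 - b)] for [exit_fun_threshold]. *)
Lemma P_b_threshold (a b e r : R) : 0 < a -> a < b -> b < 1 - r -> 0 <= r -> 0 <= e ->
  code_rate C <= r -> e <= P_b C a ->
  e * (1 - r / (1 - b)) * ln ((N.-1)%:R * (b - a)) * (b - a) <= 4.
Proof.
move=> a0 ab br r0 e0 rate hP.
have b1 : b < 1 by lra.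
have q0 : 0 < 1 - b by lra.
have T_gt1 : (1 < #|'I_N|)%N by rewrite card_ord.
pose i : 'I_N := Ordinal (ltn_trans (ltnSn 0) N_gt1).
have a01 : 0 < a < 1 by rewrite a0 (lt_trans ab b1).
have b01 : 0 < b < 1 by rewrite b1 (lt_trans a0 ab).
have ha := le_trans hP (P_b_le_exit i a01).
have := exit_fun_rate C_lin C_dt T_gt1 i b01; rewrite card_ord -code_rateE => hb.
have {}hb : exit_fun C i b <= 1 - (1 - r / (1 - b)).
  by rewrite subKr ler_pdivlMr //; apply: le_trans hb rate.
have e'0 : 0 <= 1 - r / (1 - b) by rewrite subr_ge0 ler_pdivrMr // mul1r; lra.
by have := exit_fun_threshold C_dt T_gt1 a0 ab b1 e0 e'0 ha hb; rewrite card_ord.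
Qed.

End ErasureBound.

(** * Extended BCH codes as power-sum codes indexed by the field *)

Lemma emb2_rmorphism (F : finFieldType) :
  2 \in [pchar F] -> {f : {rmorphism 'F_2 -> F} | f =1 @emb2 F}.
Proof.
move=> /andP[_ /eqP c2].
have fA : zmod_morphism (@emb2 F).
  have e1 : 1 = - 1 :> F by apply/eqP; rewrite -subr_eq0 opprK -[1 + 1]/(2%:R) c2.
  case=> -[|[|[]]] // ? -[[|[|[]]]] // ?; rewrite /emb2 /= ?subrr ?subr0 //.
  by rewrite sub0r -e1.
have fM : monoid_morphism (@emb2 F).
  split=> //; case=> -[|[|[]]] // ? -[[|[|[]]]] // ?;
    by rewrite /emb2 /= ?mul0r ?mul1r.
pose faM := GRing.isZmodMorphism.Build _ _ _ fA.
pose fmM := GRing.isMonoidMorphism.Build _ _ _ fM.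
pose fRM : {rmorphism _ -> _} := HB.pack (@emb2 F) faM fmM.
by exists fRM.
Qed.

Section BCHCode.
Variables (F : finFieldType) (m : nat) (alpha : F).
Hypotheses (m_gt0 : (0 < m)%N) (cardF : #|F| = (2 ^ m)%N).
Hypothesis alpha_prim : (#|F|.-1).-primitive_root alpha.
Local Notation N := (2 ^ m)%N.
Local Notation word := {ffun 'I_N -> 'F_2}.
Implicit Types (x c : word) (i j : 'I_N) (v k : nat) (P : {poly F}).

Let char2 : 2 \in [pchar F]. Proof. exact: (card_finPcharP cardF). Qed.
Let phi : {rmorphism 'F_2 -> F} := sval (emb2_rmorphism char2).
Let phiE : phi =1 @emb2 F. Proof. exact: (svalP (emb2_rmorphism char2)). Qed.

Let map_polyE g : map_poly (@emb2 F) g = map_poly phi g.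
Proof. by apply: eq_map_poly => b; rewrite phiE. Qed.

Lemma N_gt1 : (1 < N)%N.
Proof. by rewrite -{1}(expn0 2) ltn_exp2l. Qed.

Lemma BCH_gen_exists v : exists g, is_BCH_gen alpha v g.
Proof.
have step n : forall h : {poly 'F_2}, (size h <= n)%N -> h != 0 ->
    has_BCH_roots alpha v h -> exists g, is_BCH_gen alpha v g.
  elim: n => [|n IH] h sh h0 hr.
    by move: sh; rewrite leqn0 size_poly_eq0 (negbTE h0).
  case: (classic (exists h' : {poly 'F_2},
      [/\ h' != 0, has_BCH_roots alpha v h' & (size h' < size h)%N])).
    by case=> h' [h'0 h'r s']; apply: (IH h') => //; rewrite -ltnS (leq_trans s').
  move=> hN; exists h; split=> // h' h'0 h'r; rewrite leqNgt; apply/negP => s'.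
  by apply: hN; exists h'.
(* The descent on the size starts from this polynomial, which has all powers of [alpha] as roots. *)
pose h : {poly 'F_2} := 'X^(#|F|.-1) - 1.
have n0 := prim_order_gt0 alpha_prim.
apply: (step _ h (leqnn _)) => [|j _].
  by rewrite -size_poly_eq0 /h -[1]/(1%:P) size_XnsubC.
rewrite map_polyE rmorphB rmorph1 /= map_polyXn /root !hornerE.
by rewrite exprAC (prim_expr_order alpha_prim) expr1n subrr.
Qed.

Lemma BCH_genP v : is_BCH_gen alpha v (BCH_gen alpha v).
Proof. exact: (epsilon_spec _ _ (BCH_gen_exists v)). Qed.

Lemma BCH_gen_dvd v (h : {poly 'F_2}) :
  BCH_gen alpha v %| h <-> has_BCH_roots alpha v h.
Proof.
have [g0 gr gmin] := BCH_genP v; set g := BCH_gen alpha v in g0 gr gmin *.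
split=> [/dvdpP[q ->] j jv|hr].
  by rewrite map_polyE rmorphM /= -!map_polyE rootM gr // orbT.
rewrite /dvdp; case: (eqVneq (h %% g) 0) => //= r0.
suff : (size g <= size (h %% g)%R)%N by rewrite leqNgt ltn_modp g0.
apply: gmin => // j jv; have := hr j jv.
rewrite {1}(divp_eq h g) !map_polyE rmorphD rmorphM /= /root hornerD hornerM.
have := gr j jv; rewrite map_polyE => /rootP ->.
by rewrite mulr0 add0r.
Qed.

(* The parity coordinate is placed at the field element [0]. *)
Definition loc i : F := if (i < N - 1)%N then alpha ^+ i else 0.

(** Since [0 ^+ 0 = 1], exponent [0] gives the overall parity, parity coordinate included; for
    [k > 0] that coordinate contributes nothing. *)
Definition syndrome x k : F := \sum_i emb2 F (x i) * loc i ^+ k.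

Definition syn_code v : {set word} := [set x | [forall k : 'I_v, syndrome x k == 0]].

Lemma syn_codeP x v :
  reflect (forall k, (k < v)%N -> syndrome x k = 0) (x \in syn_code v).
Proof.
rewrite inE; apply: (iffP forallP) => [h k kv|h k]; last by rewrite h.
by apply/eqP; apply: (h (Ordinal kv)).
Qed.

Lemma horner_word_poly x k : (0 < k)%N ->
  (map_poly (@emb2 F) (word_poly x)).[alpha ^+ k] = syndrome x k.
Proof.
move=> k0; rewrite map_polyE /word_poly rmorph_sum horner_sum /syndrome.
rewrite [RHS](bigID (fun i : 'I_N => (i < N - 1)%N)) /= [in RHS]addrC.
rewrite [in RHS]big1 ?add0r => [|i]; last first.
  by rewrite /loc => /negbTE ->; rewrite expr0n gtn_eqF // mulr0.
apply: eq_bigr => i iN; rewrite rmorphM /= map_polyC map_polyXn !hornerE /= phiE.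
by rewrite /loc iN exprAC.
Qed.

(** Exponent [0] is the parity check and exponents [1, ..., v] are the prescribed roots, hence the
    shift by one. *)
Lemma eBCH_syn v : eBCH m v alpha = syn_code v.+1.
Proof.
apply/setP => x; rewrite inE.
have s0 : (\sum_(i < N) x i == 0) = (syndrome x 0 == 0).
  rewrite -(fmorph_eq0 phi) rmorph_sum; congr (_ == 0).
  by apply: eq_bigr => i _; rewrite expr0 mulr1 -phiE.
apply/andP/syn_codeP => [[/BCH_gen_dvd h e] k kv|h].
  case: k kv => [_|k kv]; first by apply/eqP; rewrite -s0.
  by rewrite -horner_word_poly //; apply/rootP/h.
split; last by rewrite s0 h.
apply/BCH_gen_dvd => k /andP[k0 kv]; apply/rootP.
by rewrite horner_word_poly // h.
Qed.

Lemma loc_inj : injective loc.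
Proof.
have n1 : (N - 1 = #|F|.-1)%N by rewrite cardF subn1.
have a0 : alpha != 0.
  apply/eqP => a0; have /eqP := prim_expr_order alpha_prim.
  by rewrite a0 expr0n gtn_eqF ?(prim_order_gt0 alpha_prim) // eq_sym oner_eq0.
have ia (i : 'I_N) : ~~ (i < N - 1)%N -> i = N.-1 :> nat.
  rewrite -leqNgt subn1 => h; apply/eqP; rewrite eqn_leq h andbT.
  by rewrite -ltnS prednK ?ltn_ord // (ltn_trans _ N_gt1).
move=> i j; rewrite /loc; case: ifPn => iN; case: ifPn => jN.
- move/eqP; rewrite (eq_prim_root_expr alpha_prim) -n1 !modn_small // => /eqP.
  exact: val_inj.
- by move/eqP; rewrite expf_eq0 (negbTE a0) andbF.
- by move/esym/eqP; rewrite expf_eq0 (negbTE a0) andbF.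
by move=> _; apply: val_inj; rewrite /= (ia _ iN) (ia _ jN).
Qed.

Lemma loc_bij : bijective loc.
Proof. by apply: inj_card_bij; [exact: loc_inj|rewrite cardF card_ord]. Qed.

(** By linearity in the coefficients of [P]. It serves both affine invariance and the triviality of
    [syn_code N]. *)
Lemma syn_code_horner x v P : x \in syn_code v -> (size P <= v)%N ->
  \sum_i emb2 F (x i) * P.[loc i] = 0.
Proof.
move=> /syn_codeP xv sP.
under eq_bigr do rewrite (horner_coef_wide _ sP) mulr_sumr.
rewrite exchange_big /= big1 // => k _.
under eq_bigr do rewrite mulrCA.
by rewrite -mulr_sumr [X in _ * X]xv ?mulr0.
Qed.

(** The power sum of exponent [k] of the permuted word is a sum over the original word of
    [(a * z + b) ^+ k], of degree at most [k] in [z]. *)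
Lemma syn_code_affine x v (a b : F) (s : {perm 'I_N}) :
  (forall i, loc (s i) = a * loc i + b) ->
  x \in syn_code v -> [ffun t => x (s^-1%g t)] \in syn_code v.
Proof.
move=> hs xv; apply/syn_codeP => k kv; rewrite /syndrome.
rewrite (reindex_inj (@perm_inj _ s)) /=.
under eq_bigr do rewrite ffunE permK hs.
rewrite -[RHS](@syn_code_horner x v ((a%:P * 'X + b%:P) ^+ k) xv).
  by apply: eq_bigr => i _; rewrite horner_exp !hornerE.
have sz : (size (a%:P * 'X + b%:P)%R <= 2)%N.
  apply: leq_trans (size_polyD _ _) _; rewrite geq_max; apply/andP; split.
    by rewrite mul_polyC (leq_trans (size_scale_leq _ _)) ?size_polyX.
  by rewrite (leq_trans (size_polyC_leq1 _)).
apply: leq_trans (size_poly_exp_leq _ _) _; apply: leq_trans _ kv.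
by rewrite ltnS -[X in (_ <= X)%N]mul1n leq_mul2r -subn1 leq_subLR sz orbT.
Qed.

Lemma syn_code_dt v : doubly_transitive (syn_code v).
Proof.
move=> i j i' j' ij ij'; have [loc' locK loc'K] := loc_bij.
have d0 : loc i - loc j != 0 by rewrite subr_eq0 (inj_eq loc_inj).
have d0' : loc i' - loc j' != 0 by rewrite subr_eq0 (inj_eq loc_inj).
(* Slope of the affine map that sends [loc i] to [loc i'] and [loc j] to [loc j']. *)
pose a := (loc i' - loc j') / (loc i - loc j).
have a0 : a != 0 by rewrite mulf_neq0 ?invr_eq0.
pose b := loc i' - a * loc i.
have sI : injective (fun t => loc' (a * loc t + b)).
  by move=> t u /(can_inj loc'K)/addIr/(mulfI a0)/loc_inj.
pose s := perm sI.
have sE t : loc (s t) = a * loc t + b by rewrite permE loc'K.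
have sVE t : loc (s^-1%g t) = a^-1 * loc t + (- b / a).
  by rewrite -{2}(permKV s t) sE; field.
exists s.
  (* One direction uses the affine map of [s], the other that of its inverse. *)
  move=> x; apply/idP/idP => xv.
    suff <- : [ffun t => [ffun u => x (s u)] (s^-1%g t)] = x.
      exact: syn_code_affine sE xv.
    by apply/ffunP => t; rewrite !ffunE permKV.
  suff <- : [ffun t => x ((s^-1)^-1%g t)] = [ffun t => x (s t)].
    exact: syn_code_affine sVE xv.
  by apply/ffunP => t; rewrite !ffunE invgK.
split; apply: loc_inj; rewrite sE /b; first by rewrite addrC subrK.
have ea : a * (loc i - loc j) = loc i' - loc j' by rewrite divfK.
by rewrite -[loc j'](subKr (loc i')) -ea mulrBr opprB addrCA.
Qed.

Lemma syndromeD x c k : syndrome (x + c) k = syndrome x k + syndrome c k.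
Proof.
rewrite -big_split; apply: eq_bigr => i _ /=.
by rewrite ffunE -!phiE rmorphD mulrDl.
Qed.

Lemma syn_code_lin v : linear_code (syn_code v).
Proof.
split=> [|x c /syn_codeP hx /syn_codeP hc]; apply/syn_codeP => k kv.
  by rewrite /syndrome big1 // => i _; rewrite ffunE -phiE rmorph0 mul0r.
by rewrite syndromeD hx // hc // addr0.
Qed.

(** Partition by the value of the next power sum, one of [2 ^ m] field elements; adding a fixed word
    of a class maps that class injectively into [syn_code v.+1]. *)
Lemma card_syn_codeS v : (#|syn_code v| <= 2 ^ m * #|syn_code v.+1|)%N.
Proof.
rewrite -sum1_card (partition_big (fun x => syndrome x v) xpredT) //=.
rewrite -[X in (_ <= X * _)%N]cardF.
rewrite -sum_nat_const; apply: leq_sum => z _.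
rewrite sum1dep_card.
case: (set_0Vmem [set x in syn_code v | syndrome x v == z]) => [->|[x0]].
  by rewrite cards0.
rewrite inE => /andP[x0v /eqP x0z].
rewrite -(card_imset _ (addrI x0)); apply: subset_leq_card.
apply/subsetP => _ /imsetP[x + ->]; rewrite inE => /andP[xv /eqP xz].
have /syn_codeP h := (syn_code_lin v).2 _ _ x0v xv.
apply/syn_codeP => k; rewrite ltnS leq_eqVlt => /orP[/eqP ->|]; last exact: h.
by rewrite syndromeD x0z xz addrr_pchar2.
Qed.

Lemma card_syn_code_full : #|syn_code N| = 1%N.
Proof.
apply/eqP/cards1P; exists 0; apply/setP => x; rewrite !inE.
apply/idP/eqP => [xN|->]; last first.
  by have /syn_codeP h := (syn_code_lin N).1; apply/forallP => k; rewrite h.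
apply/ffunP => u; rewrite ffunE.
(* [P] vanishes at every field element except [loc u], so its sum over [x] isolates the coordinate
   [x u]. *)
pose P := \prod_(z <- enum (predC1 (loc u))) ('X - z%:P).
have sP : (size P <= N)%N.
  by rewrite size_prod_XsubC -cardE cardC1 cardF prednK // (ltn_trans _ N_gt1).
have xN' : x \in syn_code N by rewrite inE.
have := syn_code_horner xN' sP; rewrite (bigD1 u) //= big1 ?addr0 => [|i iu].
  move/eqP; rewrite mulf_eq0 -phiE fmorph_eq0 => /orP[/eqP //|].
  rewrite horner_prod prodf_seq_eq0 => /hasP[z].
  by rewrite mem_enum inE /= hornerXsubC subr_eq0 eq_sym => /negbTE ->.
suff -> : P.[loc i] = 0 by rewrite mulr0.
apply/eqP; rewrite horner_prod prodf_seq_eq0; apply/hasP; exists (loc i).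
  by rewrite mem_enum inE (inj_eq loc_inj).
by rewrite hornerXsubC subrr eqxx.
Qed.

Lemma card_syn_code0 : #|syn_code 0| = (2 ^ N)%N.
Proof.
transitivity #|[set: word]|; last by rewrite cardsT card_ffun card_Fp // card_ord.
by apply: eq_card => x; rewrite in_setT; apply/syn_codeP.
Qed.

Definition log_syn v : R := ln (#|syn_code v|%:R) / ln 2.

Lemma card_syn_code_gt0 v : (0 < #|syn_code v|)%N.
Proof. by apply/card_gt0P; exists 0; apply: (syn_code_lin v).1. Qed.

Lemma ln2X n : ln ((2 ^ n)%N%:R) = n%:R * ln 2 :> R.
Proof.
elim: n => [|n IH]; first by rewrite mul0r ln1.
by rewrite expnS natrM lnM ?ltr0n ?expn_gt0 // IH -[n.+1]addn1 natrD; ring.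
Qed.

Lemma log_synS v : log_syn v <= m%:R + log_syn v.+1.
Proof.
have l0 := ln2_gt0; rewrite ler_pdivrMr // mulrDl divfK ?gt_eqF //.
rewrite -ln2X -lnM ?ltr0n ?expn_gt0 ?card_syn_code_gt0 // -natrM.
by apply: ln_mono_le; rewrite ?ltr0n ?card_syn_code_gt0 // ler_nat card_syn_codeS.
Qed.

Lemma code_rate_eBCH v : code_rate (eBCH m v alpha) = log_syn v.+1 / N%:R.
Proof. by rewrite code_rateE eBCH_syn invfM mulrA. Qed.

(** Take the least [v >= 1] of rate at most [r]; one step earlier the rate exceeds [r], and a step
    costs at most [m / N]. The factor [2] covers [v = 1], which is compared with the whole space,
    two power sums earlier. *)
Lemma eBCH_rate_near (r : R) : 0 < r -> r < 1 -> exists v,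
  [/\ (1 <= v <= N - 1)%N, code_rate (eBCH m v alpha) <= r &
      r - 2 * m%:R / N%:R <= code_rate (eBCH m v alpha)].
Proof.
move=> r0 r1; have l0 := ln2_gt0.
have n0 : 0 < N%:R :> R by rewrite ltr0n (ltn_trans _ N_gt1).
have m0 : 0 <= m%:R :> R by [].
pose Q v := (1 <= v)%N && (code_rate (eBCH m v alpha) <= r).
have QN : Q (N - 1)%N.
  rewrite /Q subn_gt0 N_gt1 code_rate_eBCH subn1 prednK ?(ltn_trans _ N_gt1) //.
  by rewrite /log_syn card_syn_code_full ln1 !mul0r ltW.
case: (ex_minnP (ex_intro Q _ QN)) => v /andP[v1 vr] vmin.
exists v; split=> //; first by rewrite v1 vmin.
rewrite code_rate_eBCH ler_pdivlMr // mulrBl divfK ?gt_eqF //.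
case: v v1 vr vmin => // -[_ _ _|v _ _ vmin].
  have := log_synS 0; have := log_synS 1.
  rewrite {3}/log_syn card_syn_code0 ln2X mulfK ?gt_eqF //; nra.
have : ~~ Q v.+1 by apply/negP => /vmin; rewrite ltnn.
rewrite /Q /= -ltNge code_rate_eBCH ltr_pdivlMr // => h.
have := log_synS v.+2; lra.
Qed.

End BCHCode.

(** * Choice of the sequence and the limits *)

Lemma sqr_le_exp2 n : (4 <= n)%N -> (n ^ 2 <= 2 ^ n)%N.
Proof.
elim: n => // n IH; rewrite leq_eqVlt => /orP[/eqP <- //|]; rewrite ltnS => n4.
have := IH n4; rewrite -!mulnn [X in (_ -> _ <= X)%N]expnS.
by move: (2 ^ n)%N => u; nia.
Qed.

Lemma Un_cvP (u : nat -> R) (l : R) : (forall e : R, 0 < e ->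
  exists M, forall n, (M <= n)%N -> `|u n - l| < e) -> Un_cv u l.
Proof.
move=> h e /RltP /h [M hM]; exists M => n /ssrnat.leP /hM.
by rewrite RdistE => /RltP.
Qed.

Lemma exists_nat_gt (x : R) : exists M : nat, x < M%:R.
Proof.
exists (Num.bound `|x|); apply: le_lt_trans (ler_norm x) _.
exact: archi_boundP.
Qed.

Lemma eBCH_capacity_achieving (r : R) (F : nat -> finFieldType) (alpha : forall m : nat, F m) :
  0 < r < 1 ->
  (forall m : nat, (0 < m)%N -> #|F m| = (2 ^ m)%N) ->
  (forall m : nat, (0 < m)%N -> (#|F m|.-1).-primitive_root (alpha m)) ->
  exists v : nat -> nat,
    (forall m : nat, (0 < m)%N -> (1 <= v m <= 2 ^ m - 1)%N) /\
    Un_cv (fun m => code_rate (eBCH m (v m) (alpha m))) r /\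
    (forall p : R, 0 <= p < 1 - r ->
       Un_cv (fun m => P_b (eBCH m (v m) (alpha m)) p) 0).
Proof.
move=> /andP[r0 r1] hF ha.
have ex m : exists v, (0 < m)%N -> [/\ (1 <= v <= 2 ^ m - 1)%N,
    code_rate (eBCH m v (alpha m)) <= r &
    r - 2 * m%:R / (2 ^ m)%N%:R <= code_rate (eBCH m v (alpha m))].
  case: (posnP m) => [->|m0]; first by exists 0%N.
  by have [v hv] := eBCH_rate_near m0 (hF m m0) (ha m m0) r0 r1; exists v.
pose v m := proj1_sig (constructive_indefinite_description _ (ex m)).
have vP m : (0 < m)%N -> _ := proj2_sig (constructive_indefinite_description _ (ex m)).
exists v; split; first by move=> m /vP[].
split.
  apply: Un_cvP => e e0; have [M hM] := exists_nat_gt (2 / e).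
  (* From [m >= 4] follows [m ^ 2 <= 2 ^ m], whence [2 * m / 2 ^ m <= 2 / m < e]. *)
  exists (maxn 4 M) => m; rewrite geq_max => /andP[m4 mM].
  have mp : (0 < m)%N by apply: leq_trans m4.
  have m0 : 0 < m%:R :> R by rewrite ltr0n.
  have [_ h1 h2] := vP m mp.
  have h3 : 2 * m%:R / (2 ^ m)%N%:R < e.
    rewrite ltr_pdivrMr ?ltr0n ?expn_gt0 //.
    have h4 : (m ^ 2)%N%:R <= (2 ^ m)%N%:R :> R by rewrite ler_nat sqr_le_exp2.
    have h5 : 2 / e < m%:R by apply: lt_le_trans hM _; rewrite ler_nat.
    apply: lt_le_trans (ler_wpM2l (ltW e0) h4).
    rewrite -mulnn natrM mulrA ltr_pM2r //.
    by move: h5; rewrite ltr_pdivrMr // mulrC.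
  by rewrite ler0_norm; lra.
move=> p /andP[p0 pr]; apply: Un_cvP => e e0.
move: p0; rewrite le_eqVlt => /orP[/eqP <-|p0].
  by exists 0%N => m _; rewrite P_b0 subrr normr0.
(* Any point strictly between [p] and [1 - r] would do. *)
pose b := (p + (1 - r)) / 2.
have pb : p < b by rewrite /b; lra.
have br : b < 1 - r by rewrite /b; lra.
have e'0 : 0 < 1 - r / (1 - b) by rewrite subr_gt0 ltr_pdivrMr ?mul1r; lra.
have d0 : 0 < b - p by lra.
(* As [m <= 2 ^ m - 1], this makes the logarithm in [P_b_threshold] too large for [P_b] to reach
   [e]. *)
have [M hM] := exists_nat_gt (exp (4 / (e * (1 - r / (1 - b)) * (b - p)) + 1) / (b - p)).
exists (maxn 1 M) => m; rewrite geq_max => /andP[mp mM].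
have [_ h1 _] := vP m mp.
have [cF pa] := (hF m mp, ha m mp).
have E := eBCH_syn cF pa (v m).
have lin : linear_code (eBCH m (v m) (alpha m)) by rewrite E; apply: syn_code_lin.
have dt : doubly_transitive (eBCH m (v m) (alpha m)).
  by rewrite E; apply: syn_code_dt.
have p01 : 0 < p < 1 by rewrite p0; lra.
rewrite subr0 ger0_norm ?P_b_ge0 // ltNge; apply/negP => eP.
have := P_b_threshold lin dt (N_gt1 mp) p0 pb br (ltW r0) (ltW e0) h1 eP.
apply/negP; rewrite -ltNge.
set L := ln _; set k := e * _.
have k0 : 0 < k * (b - p) by rewrite !mulr_gt0.
suff : 4 / (k * (b - p)) < L by rewrite ltr_pdivrMr // mulrA [L * k]mulrC.
have /RltP ex0 := exp_pos (4 / (k * (b - p)) + 1).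
apply: lt_le_trans (_ : 4 / (k * (b - p)) + 1 <= _); first by rewrite ltrDl.
rewrite -[X in X <= _]ln_exp; apply: ln_mono_le => //.
rewrite -ler_pdivrMr //; apply: le_trans (ltW hM) _.
rewrite ler_nat (leq_trans mM) // -ltnS prednK ?expn_gt0 //.
exact: ltn_expl.
Qed.

Theorem theorem8 (r : R) (hr : Rlt 0 r /\ Rlt r 1)
  (F : nat -> finFieldType) (alpha : forall m : nat, F m)
  (hF : forall m : nat, (0 < m)%N -> #|F m| = (2 ^ m)%N)
  (halpha : forall m : nat, (0 < m)%N -> ((#|F m|.-1).-primitive_root (alpha m))%R) :
  exists v : nat -> nat,
    (forall m : nat, (0 < m)%N -> (1 <= v m <= 2 ^ m - 1)%N) /\
    Un_cv (fun m => code_rate (eBCH m (v m) (alpha m))) r /\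
    (forall p : R, Rle 0 p /\ Rlt p (Rminus 1 r) ->
       Un_cv (fun m => P_b (eBCH m (v m) (alpha m)) p) R0).
Proof.
have [/RltP r0 /RltP r1] := hr.
have r01 : 0 < r < 1 by rewrite r0 r1.
have [v [hv [hrate hP]]] := eBCH_capacity_achieving r01 hF halpha.
exists v; split=> //; split=> // p [/RleP p0 /RltP p1].
by apply: hP; rewrite p0 p1.
Qed.
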